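(* Let $h$ be a morphism from a groupoid $\Gamma$ to a groupoid $\Delta$. There exist a groupoid $\tilde\Gamma$, an epimorphism $h_1$ from $\Gamma$ to $\tilde\Gamma$ and a monomorphism $h_2$ from $\tilde\Gamma$ to $\Delta$ such that $h=h_2h_1$. (Morphisms, epimorphisms and monomorphisms are in the category of groupoids with Zakrzewski morphisms.)
   Context: A relation $r$ from a set $X$ to a set $Y$ is given by its graph, a subset of $Y\times X$; we write $(y,x)\in r$. For $A\subset X$, $r(A)=\{y:\exists x\in A,\ (y,x)\in r\}$. Relations are composed by $(z,x)\in tr\iff\exists y:\ (z,y)\in t,\ (y,x)\in r$, and $r\times r_1=\{(y,y_1;x,x_1):(y,x)\in r,\ (y_1,x_1)\in r_1\}$. A groupoid $\Gamma\rightrightarrows E$ is a small category with all morphisms invertible; $\Gamma$ is the set of morphisms and $E=\Gamma^{(0)}\subset\Gamma$ the set of identities. $s(\gamma)$ is the inverse of $\gamma$. The multiplication is the relation $m$ from $\Gamma\times\Gamma$ to $\Gamma$ with $(\gamma;\gamma_1,\gamma_2)\in m$ iff $\gamma_1\gamma_2$ is defined and equals $\gamma$. A (Zakrzewski) morphism from $\Gamma\rightrightarrows E$ to $\Gamma_1\rightrightarrows E_1$ is a relation $h$ from $\Gamma$ to $\Gamma_1$ such that $hm=m_1(h\times h)$, $hs=s_1h$ and $h(E)=E_1$ (here $m_1,s_1$ are the structure relations of $\Gamma_1$). Groupoids with these morphisms form a category under composition of relations. *)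

(* Defs.v *)
From mathcomp Require Import all_boot.
From mathcomp Require Import boolp classical_sets.

Set Implicit Arguments.
Unset Strict Implicit.
Unset Printing Implicit Defensive.

Local Open Scope classical_set_scope.

(* A relation from X to Y is its graph in Y * X: the target comes first. *)
Definition hrel (X Y : Type) : Type := set (Y * X).

Definition hrel_image X Y (r : hrel X Y) (A : set X) : set Y :=
  [set y | exists2 x, A x & r (y, x)].

Definition hrel_comp X Y Z (t : hrel Y Z) (r : hrel X Y) : hrel X Z :=
  [set p | exists2 y, t (p.1, y) & r (y, p.2)].

Definition hrel_prod X Y X1 Y1 (r : hrel X Y) (r1 : hrel X1 Y1) :
    hrel (X * X1) (Y * Y1) :=
  [set p | r (p.1.1, p.2.1) /\ r1 (p.1.2, p.2.2)].

Definition hrel_graph X Y (f : X -> Y) : hrel X Y := [set p | p.1 = f p.2].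

(* A small category with all morphisms invertible.  [gcomp a b] is the
   product "a b" (first b, then a), which is [None] when it is undefined. *)
Record groupoid : Type := Groupoid {
  gob : Type;
  gmor :> Type;
  gsrc : gmor -> gob;
  gtgt : gmor -> gob;
  gid : gob -> gmor;
  gcomp : gmor -> gmor -> option gmor;
  ginv : gmor -> gmor;
  gsrc_id : forall x, gsrc (gid x) = x;
  gtgt_id : forall x, gtgt (gid x) = x;
  gcomp_defined : forall a b, isSome (gcomp a b) <-> gsrc a = gtgt b;
  gsrc_comp : forall a b c, gcomp a b = Some c -> gsrc c = gsrc b;
  gtgt_comp : forall a b c, gcomp a b = Some c -> gtgt c = gtgt a;
  gcomp_id_r : forall a, gcomp a (gid (gsrc a)) = Some a;
  gcomp_id_l : forall a, gcomp (gid (gtgt a)) a = Some a;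
  gcompA : forall a b c ab bc,
    gcomp a b = Some ab -> gcomp b c = Some bc -> gcomp ab c = gcomp a bc;
  gcomp_inv_l : forall a, gcomp (ginv a) a = Some (gid (gsrc a));
  gcomp_inv_r : forall a, gcomp a (ginv a) = Some (gid (gtgt a))
}.

Definition gunits (G : groupoid) : set G := range (@gid G).

Definition gmult (G : groupoid) : hrel (G * G) G :=
  [set p | gcomp p.2.1 p.2.2 = Some p.1].

Definition ginvr (G : groupoid) : hrel G G := hrel_graph (@ginv G).

Definition zmorphism (G H : groupoid) (h : hrel G H) : Prop :=
  [/\ hrel_comp h (@gmult G) = hrel_comp (@gmult H) (hrel_prod h h),
      hrel_comp h (@ginvr G) = hrel_comp (@ginvr H) h
    & hrel_image h (@gunits G) = @gunits H].

Definition zepi (G H : groupoid) (h : hrel G H) : Prop :=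
  zmorphism h /\
  forall (K : groupoid) (k k' : hrel H K), zmorphism k -> zmorphism k' ->
    hrel_comp k h = hrel_comp k' h -> k = k'.

Definition zmono (G H : groupoid) (h : hrel G H) : Prop :=
  zmorphism h /\
  forall (K : groupoid) (k k' : hrel K G), zmorphism k -> zmorphism k' ->
    hrel_comp h k = hrel_comp h k' -> k = k'.

(* Main.v *)
Require Import Defs.
From mathcomp Require Import all_boot.
From mathcomp Require Import boolp classical_sets.

(** A Zakrzewski morphism [h] from [G] to [D] is determined by its image sets
    [himg h g = {d | (d, g) in h}], and the axiom [h m = m (h x h)] says that
    these sets multiply pointwise: [himg h a . himg h b] is [himg h (a b)] when
    [a b] is defined, and is empty otherwise.  So the nonempty image sets are
    closed under the partial operation that sends two sets to their pointwise
    product when it is nonempty, and they form a groupoid [image_groupoid],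
    whose objects are the nonempty fibres [hbase h x] of the base map from the
    objects of [D] to those of [G].  It is the restriction of [G] to the image
    of the base map, divided by the arrows that [h] sends to units only.

    The first factor relates [g] to the single arrow [himg h g] when this set
    is nonempty.  It is a partial surjective function, hence an epimorphism.
    The second factor relates an arrow, seen as a subset of [D], to its
    elements.  Their composite is [h].

    The second factor is a monomorphism by a rigidity of Zakrzewski morphisms:
    [himg h g] contains at most one arrow with a given target
    ([himg_tgt_inj]).  If [l] and [l'] agree after composition with the second
    factor and [u] is in [l(x)], then every element of [u] lies in some [v] in
    [l'(x)].  All these [v] have the same target as [u], because fibres that
    meet coincide ([image_tgt_meet]); by rigidity of [l'] there is only one [v],
    so [u] is contained in [v].  They have the same target, so rigidity of [h]
    gives [u = v].

    Using the wide subgroupoid [h(G)] of [D] as the middle term would not do,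
    because it keeps apart the objects of [D] over one object of [G]: when [G]
    has a single arrow and [D] is a discrete groupoid with at least two objects
    and [h] relates the arrow to all of [D], the first factor is not an
    epimorphism. *)

Set Implicit Arguments.
Unset Strict Implicit.
Unset Printing Implicit Defensive.

Local Open Scope classical_set_scope.

(** * Products of arrows and of sets of arrows *)

Lemma gcomp_ex (G : groupoid) (a b : G) :
  gsrc a = gtgt b -> exists c, gcomp a b = Some c.
Proof.
by move/(gcomp_defined a b).2; case: (gcomp a b) => // c _; exists c.
Qed.

Lemma gcomp_src (G : groupoid) (a b c : G) :
  gcomp a b = Some c -> gsrc a = gtgt b.
Proof. by move=> e; apply/(gcomp_defined a b).1; rewrite e. Qed.

Lemma gsrc_inv (G : groupoid) (a : G) : gsrc (ginv a) = gtgt a.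
Proof. exact: gcomp_src (gcomp_inv_l a). Qed.

Lemma gtgt_inv (G : groupoid) (a : G) : gtgt (ginv a) = gsrc a.
Proof. by rewrite -(gcomp_src (gcomp_inv_r a)). Qed.

Lemma gid_inj (G : groupoid) : injective (@gid G).
Proof. by move=> x y /(congr1 (@gsrc G)); rewrite !gsrc_id. Qed.

Lemma gcomp_idl (G : groupoid) (x : gob G) (a c : G) :
  gcomp (gid x) a = Some c -> c = a.
Proof.
move=> e; have := gcomp_src e; rewrite gsrc_id => ex.
by move: e; rewrite ex gcomp_id_l => -[].
Qed.

Lemma gcomp_idr (G : groupoid) (x : gob G) (a c : G) :
  gcomp a (gid x) = Some c -> c = a.
Proof.
move=> e; have := gcomp_src e; rewrite gtgt_id => ex.
by move: e; rewrite -ex gcomp_id_r => -[].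
Qed.

(** The associativity law of a groupoid presupposes that both inner products
    are defined; here one of them and the outer product suffice. *)
Lemma gcompAr (G : groupoid) (a b c ab d : G) :
  gcomp a b = Some ab -> gcomp ab c = Some d ->
  exists2 bc, gcomp b c = Some bc & gcomp a bc = Some d.
Proof.
move=> eab ed.
have [|bc ebc] := @gcomp_ex G b c; first by rewrite -(gsrc_comp eab) (gcomp_src ed).
by exists bc => //; rewrite -(gcompA eab ebc).
Qed.

Lemma gcompAl (G : groupoid) (a b c bc d : G) :
  gcomp b c = Some bc -> gcomp a bc = Some d ->
  exists2 ab, gcomp a b = Some ab & gcomp ab c = Some d.
Proof.
move=> ebc ed.
have [|ab eab] := @gcomp_ex G a b; first by rewrite (gcomp_src ed) (gtgt_comp ebc).
by exists ab => //; rewrite (gcompA eab ebc).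
Qed.

Lemma gcomp_inv_unit (G : groupoid) (a b : G) (x : gob G) :
  gcomp (ginv a) b = Some (gid x) -> gsrc b = x /\ a = b.
Proof.
move=> e; split; first by rewrite -(gsrc_comp e) gsrc_id.
have [c ec] : exists c, gcomp a (gid x) = Some c.
  by apply: gcomp_ex; rewrite -gtgt_inv (gtgt_comp e).
have [ab eab eb] := gcompAl e ec.
move: eab; rewrite gcomp_inv_r => -[?]; subst ab.
by rewrite -(gcomp_idl eb) (gcomp_idr ec).
Qed.

Definition gsetM (G : groupoid) (A B : set G) : set G :=
  [set c | exists a b, [/\ A a, B b & gcomp a b = Some c]].

Lemma gsetMA (G : groupoid) (A B C : set G) :
  gsetM (gsetM A B) C = gsetM A (gsetM B C).
Proof.
rewrite eqEsubset; split=> d.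
  move=> [ab [c [[a [b [Aa Bb eab]]] Cc ed]]].
  have [bc ebc ed'] := gcompAr eab ed.
  by exists a, bc; split=> //; exists b, c.
move=> [a [bc [Aa [b [c [Bb Cc ebc]]] ed]]].
have [ab eab ed'] := gcompAl ebc ed.
by exists ab, c; split=> //; exists a, b.
Qed.

Lemma gsetM_units_r (G : groupoid) (A : set G) :
  gsetM A (@gid G @` (@gsrc G @` A)) = A.
Proof.
rewrite eqEsubset; split=> [c [a [_ [Aa [x _ <-] /gcomp_idr ->]]]|a Aa] //.
exists a, (gid (gsrc a)); split=> //; last exact: gcomp_id_r.
by exists (gsrc a) => //; exists a.
Qed.

Lemma gsetM_units_l (G : groupoid) (A : set G) :
  gsetM (@gid G @` (@gtgt G @` A)) A = A.
Proof.
rewrite eqEsubset; split=> [c [_ [a [[x _ <-] Aa /gcomp_idl ->]]]|a Aa] //.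
exists (gid (gtgt a)), a; split=> //; last exact: gcomp_id_l.
by exists (gtgt a) => //; exists a.
Qed.

Lemma gsetM_src (G : groupoid) (A B : set G) :
  @gsrc G @` A = @gtgt G @` B -> @gsrc G @` gsetM A B = @gsrc G @` B.
Proof.
move=> eAB; rewrite eqEsubset; split=> [_ [c [a [b [Aa Bb e]]] <-]|_ [b Bb <-]].
  by exists b => //; rewrite (gsrc_comp e).
have : (@gtgt G @` B) (gtgt b) by exists b.
rewrite -eAB => -[a Aa /gcomp_ex[c ec]].
by exists c; [exists a, b | exact: gsrc_comp ec].
Qed.

Lemma gsetM_tgt (G : groupoid) (A B : set G) :
  @gsrc G @` A = @gtgt G @` B -> @gtgt G @` gsetM A B = @gtgt G @` A.
Proof.
move=> eAB; rewrite eqEsubset; split=> [_ [c [a [b [Aa Bb e]]] <-]|_ [a Aa <-]].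
  by exists a => //; rewrite (gtgt_comp e).
have : (@gsrc G @` A) (gsrc a) by exists a.
rewrite eAB => -[b Bb /esym /gcomp_ex[c ec]].
by exists c; [exists a, b | exact: gtgt_comp ec].
Qed.

(** * Images and base fibres of a Zakrzewski morphism *)

Definition himg (G D : Type) (h : hrel G D) (g : G) : set D :=
  [set d | h (d, g)].

(** The fibre over [x] of the base map of [h], which goes from the objects of
    [D] back to those of [G]. *)
Definition hbase (G D : groupoid) (h : hrel G D) (x : gob G) : set (gob D) :=
  [set y | h (gid y, gid x)].

Section Images.
Variables (G D : groupoid) (h : hrel G D).
Hypothesis hh : zmorphism h.

Lemma himgM (a b c : G) :
  gcomp a b = Some c -> himg h c = gsetM (himg h a) (himg h b).
Proof.
case: hh => hM _ _ e; rewrite eqEsubset; split=> d.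
  move=> hd; have : hrel_comp h (@gmult G) (d, (a, b)) by exists c.
  by rewrite hM => -[[p q] /= epq [/= ? ?]]; exists p, q.
move=> [p [q [hp hq epq]]].
have : hrel_comp (@gmult D) (hrel_prod h h) (d, (a, b)) by exists (p, q).
by rewrite -hM => -[c' hc' /=]; rewrite /gmult /= e => -[->].
Qed.

Lemma himgM_composable (a b : G) :
  gsetM (himg h a) (himg h b) !=set0 -> gsrc a = gtgt b.
Proof.
case: hh => hM _ _ [d [p [q [hp hq epq]]]].
have : hrel_comp (@gmult D) (hrel_prod h h) (d, (a, b)) by exists (p, q).
by rewrite -hM => -[c' hc' /= /gcomp_src].
Qed.

Lemma himgV (a : G) : himg h (ginv a) = @ginv D @` himg h a.
Proof.
case: hh => _ hV _; rewrite eqEsubset; split=> d.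
  move=> hd; have : hrel_comp h (@ginvr G) (d, a) by exists (ginv a).
  by rewrite hV => -[p dp hp]; rewrite (dp : d = ginv p); exists p.
move=> [p hp <-].
have : hrel_comp (@ginvr D) h (ginv p, a) by exists p.
by rewrite -hV => -[b hb eb]; rewrite -(eb : b = ginv a).
Qed.

Lemma himg1 (x : gob G) : himg h (gid x) = @gid D @` hbase h x.
Proof.
case: hh => _ _ hE; rewrite eqEsubset; split=> [d hd|_ [y hy <-]] //.
have : hrel_image h (@gunits G) d by exists (gid x) => //; exists x.
by rewrite hE => -[y _ ey]; exists y; rewrite /hbase/= ?ey.
Qed.

Lemma hbase_total (y : gob D) : exists x, hbase h x y.
Proof.
case: hh => _ _ hE.
have : gunits (gid y) by exists y.
by rewrite -hE => -[_ [x _ <-] hx]; exists x.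
Qed.

(** Both sides are the image of the unit [a^-1 a]. It controls
    which arrows of [D] can lie in one image set. *)
Lemma himgVM (a : G) :
  gsetM (@ginv D @` himg h a) (himg h a) = @gid D @` hbase h (gsrc a).
Proof. by rewrite -himgV -himg1 -(himgM (gcomp_inv_l a)). Qed.

Lemma himgMV (a : G) :
  gsetM (himg h a) (@ginv D @` himg h a) = @gid D @` hbase h (gtgt a).
Proof. by rewrite -himgV -himg1 -(himgM (gcomp_inv_r a)). Qed.

(** An arrow [d] of [himg h a] contributes [d^-1 d] to the set of [himgVM];
    conversely a unit of this set is [p^-1 q] with [p = q]. *)
Lemma himg_src (a : G) : @gsrc D @` himg h a = hbase h (gsrc a).
Proof.
have e := himgVM a; rewrite eqEsubset; split=> [_ [d hd <-]|y hy].
  have : gsetM (@ginv D @` himg h a) (himg h a) (gid (gsrc d)).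
    by exists (ginv d), d; split; [exists d| |exact: gcomp_inv_l].
  by rewrite e => -[y hy /gid_inj <-].
have : (@gid D @` hbase h (gsrc a)) (gid y) by exists y.
rewrite -e => -[_ [q [[p hp <-] hq /gcomp_inv_unit [<- _]]]].
by exists q.
Qed.

Lemma himg_tgt (a : G) : @gtgt D @` himg h a = hbase h (gtgt a).
Proof.
rewrite -(gsrc_inv a) -himg_src himgV eqEsubset; split=> y.
  by move=> [d hd <-]; exists (ginv d); [exists d | exact: gsrc_inv].
by move=> [_ [d hd <-] <-]; exists d => //; rewrite gsrc_inv.
Qed.

(** The quotient [d^-1 d'] lies in the image of a unit of [G], hence is a unit
    of [D]. *)
Lemma himg_tgt_inj (a : G) (d d' : D) :
  himg h a d -> himg h a d' -> gtgt d = gtgt d' -> d = d'.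
Proof.
move=> hd hd' e.
have [|c ec] := @gcomp_ex D (ginv d) d'; first by rewrite gsrc_inv.
have : gsetM (@ginv D @` himg h a) (himg h a) c.
  by exists (ginv d), d'; split=> //; exists d.
by rewrite himgVM => -[y _ ey]; move: ec; rewrite -ey => /gcomp_inv_unit[].
Qed.

(** The images of the units at [x] and [x'] share the unit at [y], so their
    product is nonempty and the units at [x] and [x'] are composable. *)
Lemma hbase_inj (x x' : gob G) (y : gob D) :
  hbase h x y -> hbase h x' y -> x = x'.
Proof.
move=> hy hy'; rewrite -(gsrc_id x) -(gtgt_id x').
apply: himgM_composable; exists (gid y), (gid y), (gid y); split=> //.
by rewrite -{2}(gsrc_id y) gcomp_id_r.
Qed.

(** * The groupoid of image sets *)

Definition is_base (A : set (gob D)) := A !=set0 /\ exists x, A = hbase h x.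

Definition is_image (A : set D) := A !=set0 /\ exists g, A = himg h g.

Definition image_ob := {A | is_base A}.

Definition image_mor := {A | is_image A}.

Definition to_image (A : set D) : option image_mor :=
  if pselect (is_image A) is left p then Some (exist _ A p) else None.

Lemma sval_eq T (P : T -> Prop) (u v : {x | P x}) : sval u = sval v -> u = v.
Proof.
case: u v => [x p] [y q] /= e; subst y; by rewrite (Prop_irrelevance p q).
Qed.

Lemma to_imageP (A : set D) (u : image_mor) : to_image A = Some u <-> A = sval u.
Proof.
rewrite /to_image; case: pselect => [p|np]; split=> //.
- by case=> <-.
- by move=> e; congr Some; apply: sval_eq.
- by move=> e; case: np; rewrite e; exact: (svalP u).
Qed.

Lemma is_image_src (u : image_mor) : is_base (@gsrc D @` sval u).
Proof.
case: u => A [[d Ad] [g eA]] /=; split; first by exists (gsrc d), d.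
by exists (gsrc g); rewrite eA himg_src.
Qed.

Lemma is_image_tgt (u : image_mor) : is_base (@gtgt D @` sval u).
Proof.
case: u => A [[d Ad] [g eA]] /=; split; first by exists (gtgt d), d.
by exists (gtgt g); rewrite eA himg_tgt.
Qed.

Lemma is_image_unit (u : image_ob) : is_image (@gid D @` sval u).
Proof.
case: u => A [[y Ay] [x eA]] /=; split; first by exists (gid y), y.
by exists (gid x); rewrite eA himg1.
Qed.

Lemma is_image_inv (u : image_mor) : is_image (@ginv D @` sval u).
Proof.
case: u => A [[d Ad] [g eA]] /=; split; first by exists (ginv d), d.
by exists (ginv g); rewrite eA himgV.
Qed.

Definition image_src (u : image_mor) : image_ob := exist _ _ (is_image_src u).
Definition image_tgt (u : image_mor) : image_ob := exist _ _ (is_image_tgt u).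
Definition image_unit (u : image_ob) : image_mor := exist _ _ (is_image_unit u).
Definition image_inv (u : image_mor) : image_mor := exist _ _ (is_image_inv u).
Definition image_mul (u v : image_mor) : option image_mor :=
  to_image (gsetM (sval u) (sval v)).

(** Nonemptiness gives composable representatives in [G], whose common object
    has one fibre; conversely, equal fibres give composable arrows of [D]. *)
Lemma gsetM_nonempty (u v : image_mor) :
  gsetM (sval u) (sval v) !=set0 <-> image_src u = image_tgt v.
Proof.
case: u v => [A [A0 [a eA]]] [B [B0 [b eB]]] /=; split.
  move=> n; apply: sval_eq => /=; move: n.
  by rewrite eA eB himg_src himg_tgt => /himgM_composable ->.
move=> /(congr1 sval) /= e; case: A0 => d Ad.
have : (@gsrc D @` A) (gsrc d) by exists d.
by rewrite e => -[d' Bd' /esym /gcomp_ex[c ec]]; exists c, d, d'.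
Qed.

Lemma image_mul_defined u v :
  isSome (image_mul u v) <-> image_src u = image_tgt v.
Proof.
rewrite -gsetM_nonempty /image_mul /to_image; case: pselect => [p|np]; split=> //.
  by case: p.
case: u v np => [A [A0 [a eA]]] [B [B0 [b eB]]] /= np n; case: np; split=> //.
move: n; rewrite eA eB => /himgM_composable /gcomp_ex[c ec].
by exists c; rewrite (himgM ec).
Qed.

Lemma image_src_mul u v w :
  image_mul u v = Some w -> image_src w = image_src v.
Proof.
move=> e; have /image_mul_defined /(congr1 sval) euv : isSome (image_mul u v).
  by rewrite e.
by apply: sval_eq; move: e => /to_imageP /= <-; exact: gsetM_src.
Qed.

Lemma image_tgt_mul u v w :
  image_mul u v = Some w -> image_tgt w = image_tgt u.
Proof.
move=> e; have /image_mul_defined /(congr1 sval) euv : isSome (image_mul u v).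
  by rewrite e.
by apply: sval_eq; move: e => /to_imageP /= <-; exact: gsetM_tgt.
Qed.

Lemma image_src_unit u : image_src (image_unit u) = u.
Proof.
apply: sval_eq; rewrite /= image_comp.
by apply: eq_image_id => x _; exact: gsrc_id.
Qed.

Lemma image_tgt_unit u : image_tgt (image_unit u) = u.
Proof.
apply: sval_eq; rewrite /= image_comp.
by apply: eq_image_id => x _; exact: gtgt_id.
Qed.

Lemma image_mul_unit_r u : image_mul u (image_unit (image_src u)) = Some u.
Proof. by apply/to_imageP; rewrite gsetM_units_r. Qed.

Lemma image_mul_unit_l u : image_mul (image_unit (image_tgt u)) u = Some u.
Proof. by apply/to_imageP; rewrite gsetM_units_l. Qed.

Lemma image_mulA u v w uv vw : image_mul u v = Some uv ->
  image_mul v w = Some vw -> image_mul uv w = image_mul u vw.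
Proof. by rewrite /image_mul => /to_imageP <- /to_imageP <-; rewrite gsetMA. Qed.

Lemma image_mul_inv_l u :
  image_mul (image_inv u) u = Some (image_unit (image_src u)).
Proof.
apply/to_imageP; case: u => A [A0 [a eA]] /=.
by rewrite eA himgVM himg_src.
Qed.

Lemma image_mul_inv_r u :
  image_mul u (image_inv u) = Some (image_unit (image_tgt u)).
Proof.
apply/to_imageP; case: u => A [A0 [a eA]] /=.
by rewrite eA himgMV himg_tgt.
Qed.

Definition image_groupoid : groupoid :=
  @Groupoid image_ob image_mor image_src image_tgt image_unit image_mul image_inv
    image_src_unit image_tgt_unit image_mul_defined image_src_mul image_tgt_mul
    image_mul_unit_r image_mul_unit_l image_mulA image_mul_inv_l
    image_mul_inv_r.

(** * The two factors *)

Definition to_image_rel : hrel G image_groupoid := [set p | sval p.1 = himg h p.2].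

Definition of_image_rel : hrel image_groupoid D := [set p | sval p.2 p.1].

Lemma image_factorization : h = hrel_comp of_image_rel to_image_rel.
Proof.
rewrite eqEsubset; split=> -[d g] /=; last first.
  by move=> [u ud eu]; have : sval u d by []; rewrite (eu : sval u = _).
move=> hd; have p : is_image (himg h g) by split; [exists d | exists g].
by exists (exist _ _ p).
Qed.

Lemma to_image_zmorphism : zmorphism to_image_rel.
Proof.
split.
- rewrite eqEsubset; split=> -[u [a b]].
    move=> [c eu ec]; have {}eu : sval u = himg h c := eu.
    rewrite (himgM (ec : gcomp a b = Some c)) in eu.
    have [[d ud] _] := svalP u.
    have [p [q [hp hq _]]] : gsetM (himg h a) (himg h b) d by rewrite -eu.
    have pa : is_image (himg h a) by split; [exists p | exists a].
    have pb : is_image (himg h b) by split; [exists q | exists b].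
    exists (exist _ _ pa, exist _ _ pb) => //.
    by apply/to_imageP.
  move=> [[v w] /to_imageP eu [ev ew]].
  rewrite /= (ev : sval v = himg h a) (ew : sval w = himg h b) in eu.
  have : gsetM (himg h a) (himg h b) !=set0.
    by rewrite eu; exact: (svalP u).1.
  move=> /himgM_composable /gcomp_ex[c ec]; exists c => //.
  by rewrite /to_image_rel /= -eu (himgM ec).
- rewrite eqEsubset; split=> -[u a].
    move=> [b eu eb]; move: eu.
    rewrite (eb : b = ginv a) /to_image_rel /= himgV => eu.
    have [[d ud] _] := svalP u.
    have [p hp _] : (@ginv D @` himg h a) d by rewrite -eu.
    have pa : is_image (himg h a) by split; [exists p | exists a].
    by exists (exist _ _ pa) => //; exact: sval_eq.
  move=> [v eu ev]; exists (ginv a) => //.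
  by rewrite (eu : u = image_inv v) /to_image_rel /= himgV -(ev : sval v = himg h a).
- rewrite eqEsubset; split=> u.
    move=> [_ [x _ <-]] /= eu.
    have px : is_base (hbase h x).
      split; last by exists x.
      have [[d ud] _] := svalP u; move: ud.
      by rewrite eu himg1 => -[y hy _]; exists y.
    by exists (exist _ _ px) => //; apply: sval_eq; rewrite /= eu himg1.
  move=> [[A pA] _ <-]; have [A0 [x eA]] := pA.
  exists (gid x); first by exists x.
  by rewrite /to_image_rel /= himg1 eA.
Qed.

Lemma of_image_zmorphism : zmorphism of_image_rel.
Proof.
split.
- rewrite eqEsubset; split=> -[d [u v]].
    move=> [w /= wd /to_imageP ew]; move: wd.
    by rewrite /of_image_rel /= -ew => -[p [q [up vq e]]]; exists (p, q).
  move=> [[p q] /= e [/= up vq]].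
  have : isSome (image_mul u v).
    by apply/image_mul_defined/gsetM_nonempty; exists d, p, q.
  case ew : (image_mul u v) => [w|] // _; exists w => //.
  by rewrite /of_image_rel /=; move/to_imageP: ew => <-; exists p, q.
- rewrite eqEsubset; split=> -[d u].
    move=> [v /= vd ev]; move: vd; rewrite (ev : v = image_inv u).
    by move=> -[p up /esym ep]; exists p.
  move=> [p ep /= up]; exists (image_inv u) => //.
  by rewrite (ep : d = ginv p) /of_image_rel /=; exists p.
- rewrite eqEsubset; split=> d.
    by move=> [_ [A _ <-]] [y _ ey]; exists y.
  move=> [y _ <-]; have [x hx] := hbase_total y.
  have px : is_base (hbase h x) by split; [exists y | exists x].
  exists (image_unit (exist _ _ px)); first by exists (exist _ _ px).
  by exists y.
Qed.

(** Targets in the groupoid of images are fibres of the base map, and two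
    fibres that contain the target of [d] coincide. *)
Lemma image_tgt_meet (u v : image_mor) (d : D) :
  sval u d -> sval v d -> image_tgt u = image_tgt v.
Proof.
case: u v => [A [A0 [a eA]]] [B [B0 [b eB]]] /= ud vd; apply: sval_eq => /=.
rewrite eA eB in ud vd *; rewrite !himg_tgt; congr hbase.
apply: (@hbase_inj _ _ (gtgt d)); rewrite -himg_tgt; by exists d.
Qed.
End Images.

Arguments to_image_rel {G D h} hh _.
Arguments of_image_rel {G D h} hh _.

Lemma to_image_zepi (G D : groupoid) (h : hrel G D) (hh : zmorphism h) :
  zepi (to_image_rel hh).
Proof.
split=> [|K k k' _ _ e]; first exact: to_image_zmorphism.
suff sub (l l' : hrel (image_groupoid hh) K) :
    hrel_comp l (to_image_rel hh) = hrel_comp l' (to_image_rel hh) ->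
    l `<=` l'.
  by rewrite eqEsubset; split; apply: sub.
move=> {}e [x u] lxu; have [_ [g eu]] := svalP u.
have : hrel_comp l (to_image_rel hh) (x, g) by exists u.
rewrite e => -[v lxv ev]; rewrite (_ : u = v) //.
by apply: sval_eq; rewrite eu ev.
Qed.

Lemma of_image_zmono (G D : groupoid) (h : hrel G D) (hh : zmorphism h) :
  zmono (of_image_rel hh).
Proof.
split=> [|K k k' zk zk' e]; first exact: of_image_zmorphism.
suff sub (l l' : hrel K (image_groupoid hh)) : zmorphism l -> zmorphism l' ->
    hrel_comp (of_image_rel hh) l = hrel_comp (of_image_rel hh) l' ->
    l `<=` l'.
  by rewrite eqEsubset; split; apply: sub.
move=> {k k' zk zk' e} zl zl' e [u x] lux.
(* Each element of [u] lies in a value of [l'] at [x]; rigidity of [l'] makes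
   this value independent of the element. *)
have lift d : sval u d -> exists2 v : image_groupoid hh, sval v d & l' (v, x).
  move=> ud; have : hrel_comp (of_image_rel hh) l (d, x) by exists u.
  by rewrite e => -[v vd lvx]; exists v.
have [[d ud] _] := svalP u; have [v vd lvx] := lift d ud.
have uv : sval u `<=` sval v.
  move=> d' ud'; have [v' vd' lvx'] := lift d' ud'.
  rewrite -(himg_tgt_inj zl' lvx' lvx) //.
  by rewrite /= -(image_tgt_meet hh ud' vd') (image_tgt_meet hh ud vd).
(* Any [p] in [v] has the target of some [p'] in [u], which also lies in [v]. *)
rewrite (_ : u = v) //; apply: sval_eq; rewrite eqEsubset; split=> // p vp.
have : sval (image_tgt hh u) (gtgt p) by rewrite (image_tgt_meet hh ud vd); exists p.
move=> [p' up' epp']; have vp' := uv _ up'.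
have [_ [g ev]] := svalP v; rewrite ev in vp vp'.
by rewrite -(himg_tgt_inj hh vp' vp epp').
Qed.

Theorem proposition4p15 (G D : groupoid) (h : hrel G D) (hh : zmorphism h) :
  exists (Gt : groupoid) (h1 : hrel G Gt) (h2 : hrel Gt D),
    [/\ zepi h1, zmono h2 & h = hrel_comp h2 h1].
Proof.
exists (image_groupoid hh), (to_image_rel hh), (of_image_rel hh); split.
- exact: to_image_zepi.
- exact: of_image_zmono.
- exact: image_factorization.
Qed.
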